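(* Let $(s_1e^{i\theta_1},t_1)$ and $(s_2e^{i\theta_2},t_2)$ be non-trivial elements of the Heisenberg group $\mathbb{C}\times\mathbb{R}$, with $s_1,s_2\ge 0$ and $t_1,t_2\in\mathbb{R}$; here $\theta_1$ and $\theta_2$ are only defined when $s_1\neq 0$ and $s_2\neq 0$ respectively. Let $$A=\begin{pmatrix} 1 & -\sqrt{2}s_1e^{-i\theta_1} & -s_1^2+it_1 \\ 0 & 1 & \sqrt{2}s_1e^{i\theta_1} \\ 0 & 0 & 1 \end{pmatrix},\qquad B=\begin{pmatrix} 1 & 0 & 0 \\ \sqrt{2}s_2e^{i\theta_2} & 1 & 0 \\ -s_2^2+it_2 & -\sqrt{2}s_2e^{-i\theta_2} & 1 \end{pmatrix}$$ be the associated Heisenberg translations in $\mathrm{SU}(2,1)$, fixing $\infty$ and $o$ respectively. Replacing one of these by its inverse if necessary, suppose that $-\pi/2\le \theta_1-\theta_2\le \pi/2$. If one of the following three conditions is satisfied, then the group $\langle A,B\rangle$ is discrete and freely generated by $A$ and $B$. (1') $|s_1^2+it_1|^{1/2}\,|s_2^2+it_2|^{1/2}\ge 4$; (2') (available if $s_1\neq 0$) $s_1\,|s_2^2+it_2|^{1/2}\ge 4\cos^2\bigl((\theta_1-\theta_2)/2\bigr)$; (3') (available if $s_2\neq 0$) $|s_1^2+it_1|^{1/2}\,s_2\ge 4\cos^2\bigl((\theta_1-\theta_2)/2\bigr)$.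
   Context: $\mathrm{SU}(2,1)$ is the special unitary group of the Hermitian form $\langle \mathbf{z},\mathbf{w}\rangle=\bar w_3z_1+\bar w_2z_2+\bar w_1z_3$ of signature $(2,1)$ on $\mathbb{C}^3$. It acts on complex hyperbolic space $\mathbf{H}^2_{\mathbb{C}}$ (projectivised negative vectors) and on its boundary $\partial\mathbf{H}^2_{\mathbb{C}}$ (projectivised non-zero null vectors). The point $\infty$ is the class of $(1,0,0)^t$ and $o$ is the class of $(0,0,1)^t$. The Heisenberg group is $\mathbb{C}\times\mathbb{R}$ with group law $(\zeta_1,v_1)\cdot(\zeta_2,v_2)=(\zeta_1+\zeta_2,\,v_1+v_2+2\Im(\zeta_1\bar\zeta_2))$; its identity is $(0,0)$, so non-triviality means $(s_j,t_j)\neq(0,0)$. When $s_j=0$ the element is $(0,t_j)$, the angle $\theta_j$ is not defined, and the terms $s_je^{\pm i\theta_j}$ in the matrices are $0$. The assumption on $\theta_1-\theta_2$, and the right-hand sides of (2') and (3'), refer to the case in which both angles are defined, that is $s_1,s_2\neq 0$. ''Freely generated by $A$ and $B$'' means that $\langle A,B\rangle$ is a free group with free basis $\{A,B\}$. *)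

(* Defs.v *)
From HB Require Import structures.
From mathcomp Require Import all_boot all_order all_algebra.
From mathcomp Require Import complex ring.
From mathcomp Require Import all_classical all_reals all_analysis.

Set Implicit Arguments.
Unset Strict Implicit.
Unset Printing Implicit Defensive.

Import Order.TTheory GRing.Theory Num.Theory.
Import numFieldNormedType.Exports.

Local Open Scope classical_set_scope.
Local Open Scope ring_scope.

Section FreeBasis.
Variable gT : groupType.

Definition is_subgroup (H : set gT) : Prop :=
  [/\ H 1%g, forall x y, H x -> H y -> H (x * y)%g
    & forall x, H x -> H (x^-1)%g].

Definition generated (X : set gT) : set gT := smallest is_subgroup X.

Variables (I : eqType) (x : I -> gT).

(* The letter (i, false) stands for x i and (i, true) for (x i)^-1. *)
Definition word := seq (I * bool).

Definition reduced (w : word) : bool :=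
  sorted (fun a b : I * bool => b != (a.1, ~~ a.2)) w.

Definition word_value (w : word) : gT :=
  (\big[*%g/1]_(l <- w) if l.2 then (x l.1)^-1 else x l.1)%g.

Definition free_basis (G : set gT) : Prop :=
  G = generated (range x) /\
  forall g, G g -> exists! w : word, reduced w /\ word_value w = g.

End FreeBasis.

Section SU21.
Variable R : realType.

Definition hform (z w : 'cV[R[i]]_3) : R[i] :=
  conjc (w 2 0) * z 0 0 + conjc (w 1 0) * z 1 0 + conjc (w 0 0) * z 2 0.

Definition is_SU21 (M : 'M[R[i]]_3) : bool :=
  (\det M == 1) &&
  `[< forall z w : 'cV_3, hform (M *m z) (M *m w) = hform z w >].

Record SU21 := MkSU21 { SU21_mx :> 'M[R[i]]_3; SU21P : is_SU21 SU21_mx }.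

HB.instance Definition _ := [isSub for SU21_mx].
HB.instance Definition _ := [Choice of SU21 by <:].

Lemma SU21_one_subproof : is_SU21 1%:M.
Proof.
by apply/andP; split; [rewrite det1|apply/asboolP => z w; rewrite !mul1mx].
Qed.

Lemma SU21_mul_subproof (M N : SU21) : is_SU21 (SU21_mx M *m SU21_mx N).
Proof.
case: M N => [M /andP[/eqP dM /asboolP hM]] [N /andP[/eqP dN /asboolP hN]] /=.
apply/andP; split; first by rewrite det_mulmx dM dN mulr1.
by apply/asboolP => z w; rewrite -!mulmxA hM hN.
Qed.

Lemma SU21_inv_subproof (M : SU21) : is_SU21 (invmx (SU21_mx M)).
Proof.
case: M => [M /andP[/eqP dM /asboolP hM]] /=.
have uM : M \in unitmx by rewrite unitmxE dM unitr1.
apply/andP; split; first by rewrite det_inv dM invr1.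
by apply/asboolP => z w; rewrite -hM !mulKVmx.
Qed.

Definition SU21_one := MkSU21 SU21_one_subproof.
Definition SU21_mul (M N : SU21) := MkSU21 (SU21_mul_subproof M N).
Definition SU21_inv (M : SU21) := MkSU21 (SU21_inv_subproof M).

Lemma SU21_mulA : associative SU21_mul.
Proof. by move=> M N P; apply/val_inj/mulmxA. Qed.
Lemma SU21_mul1 : left_id SU21_one SU21_mul.
Proof. by move=> M; apply/val_inj/mul1mx. Qed.
Lemma SU21_mulr1 : right_id SU21_one SU21_mul.
Proof. by move=> M; apply/val_inj/mulmx1. Qed.
Lemma SU21_unit (M : SU21) : SU21_mx M \in unitmx.
Proof. by case: M => M /= /andP[/eqP dM _]; rewrite unitmxE dM unitr1. Qed.
Lemma SU21_mulV : left_inverse SU21_one SU21_inv SU21_mul.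
Proof. by move=> M; apply/val_inj/mulVmx/SU21_unit. Qed.
Lemma SU21_mulrV : right_inverse SU21_one SU21_inv SU21_mul.
Proof. by move=> M; apply/val_inj/mulmxV/SU21_unit. Qed.

HB.instance Definition _ := isGroup.Build SU21
  SU21_mulA SU21_mul1 SU21_mulr1 SU21_mulV SU21_mulrV.

(* SU(2,1) with the topology induced by that of the complex 3 x 3 matrices;
   the library attaches the norm topology of R[i] to the alias R[i]^o. *)
Definition SU21_topology : topologicalType :=
  initial_topology (fun M : SU21 => SU21_mx M : 'M[R[i]^o]_3).

(* The subspace topology on G is discrete. *)
Definition discrete (G : set SU21) : Prop :=
  forall M, G M -> isolated (G : set SU21_topology) M.

End SU21.

Section HeisenbergTranslations.
Variable R : realType.
Implicit Types s theta t : R.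
Local Open Scope complex_scope.

Definition expi theta : R[i] := cos theta +i* sin theta.

Definition mx3 (rows : seq (seq R[i])) : 'M[R[i]]_3 :=
  \matrix_(i < 3, j < 3) (nth [::] rows i)`_j.

Definition translation_infty_mx s theta t : 'M[R[i]]_3 := mx3
  [:: [:: 1; - ((Num.sqrt 2 * s)%:C * expi (- theta)); (- s ^+ 2) +i* t];
      [:: 0; 1; (Num.sqrt 2 * s)%:C * expi theta];
      [:: 0; 0; 1]].

Definition translation_o_mx s theta t : 'M[R[i]]_3 := mx3
  [:: [:: 1; 0; 0];
      [:: (Num.sqrt 2 * s)%:C * expi theta; 1; 0];
      [:: (- s ^+ 2) +i* t; - ((Num.sqrt 2 * s)%:C * expi (- theta)); 1]].

Lemma conjcM (x y : R[i]) : conjc (x * y) = conjc x * conjc y.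
Proof. exact: rmorphM. Qed.

Lemma conjcD (x y : R[i]) : conjc (x + y) = conjc x + conjc y.
Proof. exact: rmorphD. Qed.

Lemma conjcN (x : R[i]) : conjc (- x) = - conjc x.
Proof. exact: rmorphN. Qed.

Lemma expiN theta : expi (- theta) = conjc (expi theta).
Proof. by rewrite /expi cosN sinN. Qed.

Lemma expi_conj theta : expi theta * conjc (expi theta) = 1.
Proof.
rewrite /expi; apply/eqP; rewrite eq_complex /= -(cos2Dsin2 theta).
by apply/andP; split; apply/eqP; ring.
Qed.

Lemma heis_coef s theta t :
  let a := (Num.sqrt 2 * s)%:C * expi theta in
  let c := (- s ^+ 2) +i* t in c + conjc c = - (a * conjc a).
Proof.
move=> a c; rewrite /a conjcM conjc_real mulrACA expi_conj mulr1 /c.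
have h : (Num.sqrt 2 * s) ^+ 2 = 2 * s ^+ 2 :> R by rewrite exprMn sqr_sqrtr.
rewrite -(rmorphM (real_complex R)) -expr2 h.
by apply/eqP; rewrite eq_complex /=; apply/andP; split; apply/eqP; ring.
Qed.

Lemma heis_conj s theta :
  (Num.sqrt 2 * s)%:C * expi (- theta) =
  conjc ((Num.sqrt 2 * s)%:C * expi theta) :> R[i].
Proof. by rewrite expiN conjcM conjc_real. Qed.

Lemma det3 (M : 'M[R[i]]_3) : \det M =
  M 0 0 * (M 1 1 * M 2 2 - M 1 2 * M 2 1)
  - M 0 1 * (M 1 0 * M 2 2 - M 1 2 * M 2 0)
  + M 0 2 * (M 1 0 * M 2 1 - M 1 1 * M 2 0).
Proof.
rewrite (expand_det_row _ 0) !big_ord_recl big_ord0 /cofactor.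
rewrite !(expand_det_row _ 0) !big_ord_recl !big_ord0 /cofactor !det_mx11.
rewrite !mxE /=.
have [f e] : exists f : nat -> nat -> R[i], forall i j : 'I_3, M i j = f i j.
  by exists (fun i j => M (inord i) (inord j)) => i j; rewrite !inord_val.
rewrite !e /= /bump /= !addn0 !add0n ?addn1 /=.
ring.
Qed.

Lemma mx3_mul rows (z : 'cV[R[i]]_3) (i : 'I_3) :
  (mx3 rows *m z) i 0 = (nth [::] rows i)`_0 * z 0 0
    + (nth [::] rows i)`_1 * z 1 0 + (nth [::] rows i)`_2 * z 2 0.
Proof.
rewrite mxE !big_ord_recl big_ord0 !mxE addr0 addrA /=.
by congr (_ + _ * z _ _ + _ * z _ _); apply/val_inj.
Qed.

Lemma translation_infty_subproof s theta t :
  is_SU21 (translation_infty_mx s theta t).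
Proof.
rewrite /translation_infty_mx heis_conj.
have := heis_coef s theta t; cbv zeta.
set a := _ * expi theta; set c := (- s ^+ 2) +i* t => h; clearbody a c.
apply/andP; split; first by rewrite det3 !mxE /=; apply/eqP; ring.
apply/asboolP => z w; rewrite /hform !mx3_mul /=.
have hc : conjc c = - (a * conjc a) - c by rewrite -h addrC addKr.
rewrite !(conjcD, conjcM, conjcN, conjc1, conjc0, conjcK).
by rewrite hc; ring.
Qed.

Lemma translation_o_subproof s theta t : is_SU21 (translation_o_mx s theta t).
Proof.
rewrite /translation_o_mx heis_conj.
have := heis_coef s theta t; cbv zeta.
set a := _ * expi theta; set c := (- s ^+ 2) +i* t => h; clearbody a c.
apply/andP; split; first by rewrite det3 !mxE /=; apply/eqP; ring.
apply/asboolP => z w; rewrite /hform !mx3_mul /=.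
have hc : conjc c = - (a * conjc a) - c by rewrite -h addrC addKr.
rewrite !(conjcD, conjcM, conjcN, conjc1, conjc0, conjcK).
by rewrite hc; ring.
Qed.

Definition translation_infty s theta t : SU21 R :=
  MkSU21 (translation_infty_subproof s theta t).
Definition translation_o s theta t : SU21 R :=
  MkSU21 (translation_o_subproof s theta t).

(* |s^2 + i t|^(1/2), the Cygan norm of (s e^(i theta), t). *)
Definition cygan s t : R := Num.sqrt (Normc.normc ((s ^+ 2) +i* t)).

End HeisenbergTranslations.

(* Main.v *)
(* Klein's combination theorem on the null vectors of the Hermitian form: if
   every nontrivial power of A maps U into V and every nontrivial power of B maps
   V into U, then a reduced word becomes, after conjugation by A or A^-1, a word
   mapping U into V.  As a point of U is not in the closure of V, such words stay
   away from the identity, which gives both freeness and discreteness.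

   Under (1'), U and V are the inside and the outside of a Cygan sphere centred at
   o.  Under (2'), U is an open fan |Re (e^(- i theta_1) zeta) - c| < s_1 / 2 and V
   the complement of the closed fan: A shifts the fan by s_1, and what has to be
   shown is that the fan contains the interiors of the isometric spheres of all the
   powers B^k.  These spheres project to discs of radius |B^k|^-1, and c is chosen
   so that the discs of B and B^-1 lie symmetrically in the fan.  Condition (3') is
   (2') conjugated by the involution exchanging o and infinity. *)
Require Import Defs.
From mathcomp Require Import all_boot all_order all_algebra.
From mathcomp Require Import complex ring lra.
From mathcomp Require Import all_classical all_reals all_analysis.

Set Implicit Arguments.
Unset Strict Implicit.
Unset Printing Implicit Defensive.

Import Order.TTheory GRing.Theory Num.Theory.
Import numFieldNormedType.Exports.

(** * Reduced words and a criterion for a free basis *)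

Section FreeBasisCriterion.
Variables (gT : groupType) (I : eqType) (x : I -> gT).
Implicit Types (w : word I) (l : I * bool).
Local Open Scope group_scope.

Definition letter_value l : gT := if l.2 then (x l.1)^-1 else x l.1.
Definition letter_inv l := (l.1, ~~ l.2).
Definition word_inv w : word I := rev (map letter_inv w).

Lemma letter_invK : involutive letter_inv.
Proof. by case=> i e; rewrite /letter_inv /= negbK. Qed.

Lemma letter_inv_neq l : l != letter_inv l.
Proof. by case: l => i []; rewrite /letter_inv xpair_eqE andbF. Qed.

Lemma letter_value_inv l : letter_value (letter_inv l) = (letter_value l)^-1.
Proof. by case: l => i [] /=; rewrite /letter_value /= ?invgK. Qed.

Lemma word_value_cons l w : word_value x (l :: w) = letter_value l * word_value x w.
Proof. exact: big_cons. Qed.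

Lemma word_value_nil : word_value x [::] = 1.
Proof. exact: big_nil. Qed.

Lemma word_value_cat w1 w2 :
  word_value x (w1 ++ w2) = word_value x w1 * word_value x w2.
Proof. exact: big_cat. Qed.

Lemma word_value_rcons w l :
  word_value x (rcons w l) = word_value x w * letter_value l.
Proof. by rewrite -cats1 word_value_cat word_value_cons word_value_nil mulg1. Qed.

Lemma word_value_inv w : word_value x (word_inv w) = (word_value x w)^-1.
Proof.
elim: w => [|l w IHw]; first by rewrite /word_inv /= word_value_nil invg1.
rewrite /word_inv /= rev_cons word_value_rcons -/(word_inv w) IHw.
by rewrite letter_value_inv word_value_cons invgM.
Qed.

Lemma reduced_cons l l' w :
  reduced (l :: l' :: w) = (l' != letter_inv l) && reduced (l' :: w).
Proof. by []. Qed.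

Lemma reduced_behead l w : reduced (l :: w) -> reduced w.
Proof. rewrite /reduced /=.  exact: path_sorted. Qed.

Lemma reduced_inv w : reduced w -> reduced (word_inv w).
Proof.
rewrite /reduced /word_inv rev_sorted sorted_map.
by apply: sub_sorted => l l'; rewrite /= negbK -surjective_pairing eq_sym.
Qed.

Lemma reduced_cat l w1 w2 : reduced (l :: w1) -> reduced w2 ->
  (if w2 is l' :: _ then l' != letter_inv (last l w1) else true) ->
  reduced (l :: w1 ++ w2).
Proof.
case: w2 => [|l' w2]; first by rewrite cats0.
by rewrite /reduced /= cat_path /= => -> -> ->.
Qed.

Lemma reduced_eqv w : exists w', reduced w' /\ word_value x w' = word_value x w.
Proof.
elim: w => [|l w [[|l' w'] [rw' ew']]]; first by exists [::].
  by exists [:: l]; rewrite !word_value_cons -ew'.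
have [e|ne] := eqVneq l' (letter_inv l); last first.
  by exists (l :: l' :: w'); rewrite reduced_cons ne rw' !word_value_cons -ew' !word_value_cons.
exists w'; split; first exact: reduced_behead rw'.
by rewrite word_value_cons -ew' word_value_cons e letter_value_inv mulVKg.
Qed.

Lemma generated_word_value :
  generated (range x) = [set g | exists w, word_value x w = g]%classic.
Proof.
apply/seteqP; split=> g.
  apply; split.
    split; first by exists [::]; rewrite word_value_nil.
      by move=> _ _ [w1 <-] [w2 <-]; exists (w1 ++ w2); rewrite word_value_cat.
    by move=> _ [w <-]; exists (word_inv w); rewrite word_value_inv.
  move=> _ [i _ <-]; exists [:: (i, false)].
  by rewrite word_value_cons word_value_nil mulg1.
move=> [w <-] H [[H1 HM HV] xH].
elim: w => [|[i e] w IHw]; first by rewrite word_value_nil.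
rewrite word_value_cons; apply: (HM _ _ _ IHw).
by case: e; [apply: HV|]; apply: xH; exists i.
Qed.

(** Equal first letters are stripped. If the first letters differ, the inverse of one word followed
    by the other is a nonempty reduced word of value [1]. *)
Lemma reduced_word_value_inj :
  (forall w, reduced w -> w != [::] -> word_value x w <> 1) ->
  forall w1 w2, reduced w1 -> reduced w2 ->
    word_value x w1 = word_value x w2 -> w1 = w2.
Proof.
move=> nontriv; elim=> [|l1 w1 IHw] [|l2 w2] // r1 r2.
- by rewrite word_value_nil => /esym e; case: (nontriv _ r2 isT e).
- by rewrite word_value_nil => e; case: (nontriv _ r1 isT e).
have [->|ne] := eqVneq l1 l2; last first.
  move=> e; have := reduced_inv r2; have := word_value_inv (l2 :: w2).
  rewrite /word_inv /= rev_cons.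
  (* The split exposes the head letter of the inverse word, as [reduced_cat] requires; its last
     letter is [letter_inv l2] in both cases. *)
  case: (rev _) => [|l w] /= ve ri; [case: (nontriv [:: letter_inv l2, l1 & w1])|
      case: (nontriv (l :: rcons w (letter_inv l2) ++ l1 :: w1))] => //.
  + by rewrite reduced_cons letter_invK ne.
  + by rewrite -[LHS]/(word_value x ([:: letter_inv l2] ++ l1 :: w1)) word_value_cat ve e mulVg.
  + by apply: reduced_cat => //; rewrite last_rcons letter_invK.
  + by rewrite -cat_cons word_value_cat ve e mulVg.
rewrite !word_value_cons => /mulgI e; congr (_ :: _).
by apply: IHw e; [exact: reduced_behead r1|exact: reduced_behead r2].
Qed.

Lemma free_basis_criterion :
  (forall w, reduced w -> w != [::] -> word_value x w <> 1) ->
  free_basis x (generated (range x)).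
Proof.
move=> nontriv; split=> // g; rewrite generated_word_value => -[w <-].
have [w' [rw' ew']] := reduced_eqv w; exists w'; split=> // w'' [rw'' ew''].
by apply: reduced_word_value_inj => //; rewrite ew''.
Qed.

End FreeBasisCriterion.

(** * Ping-pong for reduced words in two generators *)

Section PingPong.
Variables (gT : groupType) (x : bool -> gT) (T : Type) (act : gT -> T -> T).
Hypothesis actM : forall g h z, act (g * h)%g z = act g (act h z).
Variable D : bool -> set T.
Hypothesis powD : forall b e n z, D b z ->
  D (~~ b) (act (letter_value x (b, e) ^+ n.+1)%g z).

(** Adjacent equal letters must be gathered before [powD] applies, since it concerns a whole power
    acting on [D b]. The leading power is therefore left unapplied, at a point [y] still in the
    domain of its generator. *)
Lemma act_reduced l w z : reduced (l :: w) -> D (last l w).1 z ->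
  exists n y, D l.1 y /\
    act (word_value x (l :: w)) z = act (letter_value x l ^+ n.+1)%g y.
Proof.
elim: w l => [|l' w IHw] l.
  by move=> _ /= Dz; exists 0, z; rewrite word_value_cons word_value_nil mulg1 expg1.
rewrite reduced_cons => /andP[ne rw] Dz; rewrite word_value_cons actM.
have [n [y [Dy ->]]] := IHw l' rw Dz.
have [e|ne1] := eqVneq l'.1 l.1; last first.
  exists 0; exists (act (letter_value x l' ^+ n.+1) y)%g; split; last by rewrite expg1.
  have -> : l.1 = ~~ l'.1 by move: ne1; case: l.1; case: l'.1.
  by rewrite [l' in letter_value _ l']surjective_pairing; apply: powD.
exists n.+1, y; rewrite -e -actM [in RHS]expgS; split=> //.
(* Over the same generator, reducedness excludes [letter_inv l], so the leading power grows by
   one. *)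
suff -> : l' = l by [].
apply/eqP; move: ne; rewrite -!pair_eqE /= e !eqxx /=.
by case: l'.2; case: l.2.
Qed.

Lemma act_reduced_dom l w z : reduced (l :: w) -> D (last l w).1 z ->
  D (~~ l.1) (act (word_value x (l :: w)) z).
Proof.
move=> rw /(act_reduced rw)[n [y [Dy ->]]].
by rewrite [l in letter_value _ l]surjective_pairing; apply: powD.
Qed.

Variable a : bool.

(* Conjugating by a letter [x a] or its inverse, chosen so as not to cancel,
   makes both ends of a reduced word powers of [x a]. *)
Lemma reduced_conj_dom w : reduced w -> w != [::] ->
  exists2 c, c \in [:: 1; x a; (x a)^-1]%g &
    forall z, D a z -> D (~~ a) (act (c * word_value x w * c^-1)%g z).
Proof.
case: w => // l w rw _.
have letter_a c : c.1 = a -> letter_value x c \in [:: 1; x a; (x a)^-1]%g.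
  by case: c => i e /= ->; case: e; rewrite /letter_value !inE eqxx ?orbT.
(* If only one end is a power of [x a], the conjugator is the first letter or the inverse of the
   last one, so that this end grows instead of cancelling. *)
have [la|la] := eqVneq l.1 a; have [lb|lb] := eqVneq (last l w).1 a.
- exists 1%g; first by rewrite !inE eqxx.
  by move=> z Dz; rewrite invg1 mulg1 mul1g -la; apply: act_reduced_dom; rewrite ?lb.
- exists (letter_value x l); first exact: letter_a.
  move=> z Dz; rewrite -word_value_cons -letter_value_inv -word_value_rcons /= -la.
  apply: act_reduced_dom; last by rewrite /= last_rcons /= la.
  rewrite -cats1; apply: (@reduced_cat _ l (l :: w) [:: letter_inv l]) => //.
    by rewrite reduced_cons rw andbT letter_inv_neq.
  by rewrite /=; apply: contraNneq lb => /(congr1 fst)/= <-; rewrite la.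
- set c := letter_inv (last l w).
  exists (letter_value x c); first exact: letter_a.
  move=> z Dz; rewrite -word_value_cons -letter_value_inv letter_invK -word_value_rcons /=.
  have -> : a = c.1 by rewrite /= lb.
  apply: act_reduced_dom; last by rewrite /= last_rcons lb.
  rewrite -cats1; apply: (@reduced_cat _ c (l :: w) [:: last l w]) => //.
    rewrite reduced_cons rw andbT letter_invK.
    by apply: contraNneq la => ->; rewrite lb.
  by rewrite /= letter_inv_neq.
- exists (x a); first by rewrite !inE eqxx orbT.
  move=> z Dz; rewrite -[x a]/(letter_value x (a, false)) -word_value_cons.
  rewrite -letter_value_inv -word_value_rcons /= -[a in ~~ a]/((a, false).1).
  apply: act_reduced_dom; last by rewrite /= last_rcons.
  rewrite -cats1; apply: (@reduced_cat _ (a, false) (l :: w) [:: (a, true)]) => //.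
    by rewrite reduced_cons rw andbT; apply: contraNneq la => ->.
  by rewrite /=; apply: contraNneq lb => /(congr1 fst)/= <-.
Qed.

End PingPong.

Local Open Scope classical_set_scope.
Local Open Scope ring_scope.

(** * Real inequalities behind the fan estimate *)

Lemma Cauchy_2d (R : realFieldType) (a b c d : R) :
  (a * c + b * d) ^+ 2 <= (a ^+ 2 + b ^+ 2) * (c ^+ 2 + d ^+ 2).
Proof. by have := sqr_ge0 (a * d - b * c); nra. Qed.

Lemma fourth_root (R : rcfType) (x : R) : 0 < x -> exists2 y, 0 < y & y ^+ 4 * x = 1.
Proof.
move=> x0; exists (Num.sqrt (Num.sqrt x^-1)); first by rewrite !sqrtr_gt0 invr_gt0.
rewrite (exprM _ 2 2) sqr_sqrtr ?sqrtr_ge0// sqr_sqrtr ?invr_ge0 ?ltW//.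
by rewrite mulVf// gt_eqF.
Qed.

(* All that is used of a nonzero integer [k]. *)
Definition int_sqr (R : realFieldType) (k : R) := (k ^+ 2 == 1) || (4 <= k ^+ 2).

(* Here lengths are scaled so that [B] has Cygan norm 1, [r] is the radius of the
   disc onto which the isometric sphere of [B^k] projects, and [c], [d] are the
   cosine and sine of [theta_1 - theta_2]. *)
Lemma ball_in_strip_scaled (R : rcfType) (k x t c d : R) : 0 <= x -> x ^+ 4 + t ^+ 2 = 1 ->
  0 <= c -> c ^+ 2 + d ^+ 2 = 1 -> int_sqr k ->
  let D := k ^+ 2 * x ^+ 4 + t ^+ 2 in
  exists r, [/\ 0 < r, r ^+ 4 * (k ^+ 2 * D) = 1 &
    `|x * (k * x ^+ 2 * c - t * d) / D + x * t * d| + r <= 1 + c].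
Proof.
move=> x0 xt c0 cd sk D.
have k1 : 1 <= k ^+ 2 by case/orP: sk => [/eqP ->//|]; lra.
have x40 : 0 <= x ^+ 4 by apply: exprn_ge0.
have x1 : x <= 1.
  have t2 := sqr_ge0 t; rewrite leNgt; apply/negP => x1.
  have : 1 < x ^+ 4 by rewrite exprn_egt1.
  lra.
have D1 : 1 <= D by rewrite -xt /D; nra.
have D0 : 0 < D by lra.
have d1 : `|d| <= 1 by rewrite -(@ler_pXn2r _ 2)// ?nnegrE// expr1n -normrX ger0_norm; nra.
have Dinv0 : 0 < D^-1 by rewrite invr_gt0.
have Dinv1 : D^-1 <= 1 by rewrite invf_le1.
have [r r0 rE] : exists2 r, 0 < r & r ^+ 4 * (k ^+ 2 * D) = 1.
  by apply: fourth_root; apply: mulr_gt0 => //; lra.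
exists r; split=> //.
have kx : `|k * x ^+ 3| <= D.
  rewrite normrM (ger0_norm (exprn_ge0 _ x0)).
  have : `|k| * x ^+ 3 <= `|k| * x ^+ 2.
    by rewrite ler_wpM2l// ler_wiXn2l.
  move=> /le_trans; apply.
  have := real_normK (num_real k); move: (normr_ge0 k) sk; rewrite /int_sqr.
  rewrite /D; have -> : t ^+ 2 = 1 - x ^+ 4 by lra.
  have -> : x ^+ 4 = (x ^+ 2) ^+ 2 by rewrite -exprM.
  have : 0 <= x ^+ 2 <= 1 by rewrite sqr_ge0 expr_le1.
  move: (x ^+ 2) (`|k|) => y m /andP[y0 y1] m0 + mk; rewrite -mk.
  case/orP => [|m4]; first by rewrite pexpr_eq1// => /eqP ->; lra.
  (* The square gives [m * y <= (m * y)^2 / 4 + 1], and [m^2 >= 4] makes the remaining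
     [3/4 * (m * y)^2] at least [y^2]. *)
  have := sqr_ge0 (m * y / 2 - 1); nra.
have xt58 : `|x * t| <= 5 / 8.
  have r58 : 0 <= 5 / 8 :> R by lra.
  rewrite -(@ler_pXn2r _ 2)// -normrX ger0_norm ?sqr_ge0// exprMn.
  have -> : t ^+ 2 = 1 - (x ^+ 2) ^+ 2 by rewrite -exprM; lra.
  move: (x ^+ 2) (sqr_ge0 x) => y y0.
  (* On [y >= 0], [y - y^3] has maximum [2 / (3 sqrt 3)], slightly less than [(5/8)^2], at
     [1 / sqrt 3], which [15/26] approximates. *)
  have := mulr_ge0 (addr_ge0 y0 (ler0n R 1)) (sqr_ge0 (y - 15 / 26)).
  have := mulr_ge0 y0 (sqr_ge0 (y - 15 / 26)). have := (sqr_ge0 (y - 15 / 26)).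
  nra.
(* The two terms are bounded by [c] and [5/8 * (1 - D^-1)], which leaves [3/8 + 5/8 * D^-1] for
   [r]. *)
have -> : x * (k * x ^+ 2 * c - t * d) / D + x * t * d =
    k * x ^+ 3 / D * c + x * t * d * (1 - D^-1).
  by field; rewrite gt_eqF.
have b1 : `|k * x ^+ 3 / D * c| <= c.
  rewrite normrM (ger0_norm c0) normrM (gtr0_norm Dinv0) ler_piMl// ler_pdivrMr// mul1r //.
have b2 : `|x * t * d * (1 - D^-1)| <= 5 / 8 * (1 - D^-1).
  rewrite normrM (@ger0_norm _ (1 - _)) ?subr_ge0// ler_wpM2r ?subr_ge0//.
  by rewrite normrM (le_trans _ xt58)// ler_piMr.
have rb : r <= 3 / 8 + 5 / 8 * D^-1.
  case/orP: sk => [/eqP k21|k24].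
    have D1E : D = 1 by rewrite /D k21 mul1r.
    move: rE; rewrite D1E invr1 k21 !mulr1 => /eqP.
    by rewrite pexpr_eq1 ?(ltW r0)// => /eqP ->; lra.
  have : 4 * r ^+ 4 <= D^-1.
    have : r ^+ 4 * D * 4 <= r ^+ 4 * D * k ^+ 2.
      by rewrite ler_pM2l// mulr_gt0// exprn_gt0.
    by rewrite -[D^-1]mul1r ler_pdivlMr//; move: rE; lra.
  have -> : r ^+ 4 = (r ^+ 2) ^+ 2 by rewrite -exprM.
  (* It remains that [5/2 * r^4 - r + 3/8 >= 0]. The minimum is positive and occurs at [r^3 = 1/10],
     where [r] and [r^2] are close to [93/200] and [43/200]. *)
  have := sqr_ge0 (r ^+ 2 - 43 / 200); have := sqr_ge0 (r - 93 / 200); nra.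
have := ler_normD (k * x ^+ 3 / D * c) (x * t * d * (1 - D^-1)).
lra.
Qed.

(** * Continuity of matrix maps *)

Lemma mx_continuous (S T : topologicalType) m n (f : S -> 'M[T]_(m, n)) (s : S) :
  (forall i j, {for s, continuous (fun x => f x i j)}) -> {for s, continuous f}.
Proof.
move=> cf A [Q nQ QA]; apply: filterS (QA) _.
have : \forall x \near s, forall ij : 'I_m * 'I_n, Q ij.1 ij.2 (f x ij.1 ij.2).
  by apply: filter_forall => ij; apply: cf; exact: nQ.
by apply: filterS => x Qx i j; exact: (Qx (i, j)).
Qed.

Lemma mulmx_continuous (K : numFieldType) m n p q (P : 'M[K]_(m, n)) (Q : 'M[K]_(p, q)) :
  continuous (fun X : 'M[K]_(n, p) => P *m X *m Q).
Proof.
move=> X; apply: mx_continuous => i j.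
have -> : (fun Y : 'M[K]_(n, p) => (P *m Y *m Q) i j) =
    (fun Y => \sum_k (\sum_l P i l * Y l k) * Q k j).
  by apply/funext => Y; rewrite mxE; apply: eq_bigr => k _; rewrite mxE.
move: X; apply: continuous_big => [|k _]; first exact: add_continuous.
move=> X; apply: continuousM; last exact: cst_continuous.
move: X; apply: continuous_big => [|l _]; first exact: add_continuous.
move=> X; apply: continuousM; first exact: cst_continuous.
exact: coord_continuous.
Qed.

(** * Freeness and discreteness from ping-pong on vectors *)

Section SU21PingPong.
Variables (R : realType) (x : bool -> SU21 R) (D : bool -> set 'cV[R[i]]_3).
Hypothesis powD : forall b e n z, D b z ->
  D (~~ b) (SU21_mx (letter_value x (b, e) ^+ n.+1)%g *m z).
Variables (a : bool) (u : 'cV[R[i]^o]_3).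
Hypotheses (Du : D a u) (D_near : \forall z \near u, ~ D (~~ a) z).

Let act (M : SU21 R) (z : 'cV[R[i]]_3) := SU21_mx M *m z.

Let act1 z : act 1%g z = z. Proof. exact: mul1mx. Qed.
Let actM (M N : SU21 R) z : act (M * N)%g z = act M (act N z).
Proof. by rewrite /act mulmxA. Qed.

Let conj_dom w := reduced_conj_dom actM powD a (w := w).

Lemma ping_pong_free : free_basis x (generated (range x)).
Proof.
apply: free_basis_criterion => w rw w0 ew.
have [c _ /(_ _ Du)] := conj_dom rw w0.
by rewrite ew mulg1 mulgV act1; exact: nbhs_singleton D_near.
Qed.

Lemma near_conj (c M N : SU21 R) (A : set 'cV[R[i]^o]_3) :
  nbhs (SU21_mx (c * N * M)%g *m u : 'cV[R[i]^o]_3) A ->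
  \forall X \near (N : SU21_topology R), A (SU21_mx (c * X * M)%g *m u).
Proof.
rewrite /= -!mulmxA => nA.
have nX : nbhs (SU21_mx N : 'M[R[i]^o]_3)
    [set X | A (SU21_mx c *m X *m (SU21_mx M *m u))].
  by apply: (@mulmx_continuous R[i] 3 3 3 1 _ _ _ A); rewrite -mulmxA.
have := @initial_continuous _ _ (fun X : SU21 R => SU21_mx X : 'M[R[i]^o]_3) N _ nX.
rewrite /= nbhs_filterE; congr (nbhs _ _).
by apply/funext => X /=; rewrite -!mulmxA.
Qed.

Let conj_fix c M : SU21_mx (c * M * (M^-1 * c^-1))%g *m u = u.
Proof. by rewrite mulgA mulgK mulgV; exact: mul1mx. Qed.

(** Near [M], each of the three conjugates of [N * M^-1] by [1], [x a], [(x a)^-1] keeps [u] out of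
    [D (~~ a)], by continuity. For [N] in the group and distinct from [M], a nonempty reduced word
    represents [N * M^-1], and one of these conjugates takes [u] into [D (~~ a)]. *)
Lemma ping_pong_discrete : discrete (generated (range x)).
Proof.
move=> M GM; split; first exact/mem_set.
have near_c c : \forall N \near (M : SU21_topology R),
    ~ D (~~ a) (SU21_mx (c * N * (M^-1 * c^-1))%g *m u).
  apply: (@near_conj c (M^-1 * c^-1)%g M [set z | ~ D (~~ a) z]).
  by rewrite conj_fix.
exists [set N | forall c, c \in [:: 1; x a; (x a)^-1]%g ->
    ~ D (~~ a) (SU21_mx (c * N * (M^-1 * c^-1))%g *m u)].
  have := near_c 1%g; have := near_c (x a); have := near_c (x a)^-1%g.
  apply: filterS3 => N h1 h2 h3 c.
  by rewrite !inE => /or3P[] /eqP ->.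
apply/seteqP; split=> [N [notD GN]|_ ->]; last first.
  split=> // c _ /=; rewrite conj_fix.
  exact: nbhs_singleton D_near.
move: GM GN; rewrite generated_word_value => -[v ev] [v' ev'].
have [w [rw ew]] := reduced_eqv x (v' ++ word_inv v).
rewrite word_value_cat word_value_inv ev ev' in ew.
have [w0|w0] := eqVneq w [::].
  by move: ew; rewrite w0 word_value_nil => /esym/divg1_eq.
have [c c_in /(_ _ Du)] := conj_dom rw w0.
rewrite ew => Dc; suff: D (~~ a) (SU21_mx (c * N * (M^-1 * c^-1))%g *m u) by move=> /(notD c c_in).
by move: Dc; rewrite /act !mulgA.
Qed.

End SU21PingPong.

(** * Heisenberg translations in one direction, and the involution exchanging [o] and infinity *)

Section Translations.
Variable R : realType.
Local Open Scope complex_scope.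
Implicit Types s theta t k : R.

(** With a common angle the term [2 Im (zeta_1 conj zeta_2)] of the Heisenberg law vanishes, so the
    parameters simply add. *)
Lemma translation_inftyD s theta t s' t' :
  (translation_infty s theta t * translation_infty s' theta t')%g =
  translation_infty (s + s') theta (t + t').
Proof.
apply/val_inj => /=; rewrite /translation_infty_mx !heis_conj.
have ee : expi theta * conjc (expi theta) = 1 := expi_conj theta.
have sq : (Num.sqrt 2 * s)%:C * (Num.sqrt 2 * s')%:C = (2 * s * s')%:C :> R[i].
  rewrite -rmorphM mulrACA -expr2 sqr_sqrtr//; congr (_%:C); ring.
have sD : (Num.sqrt 2 * (s + s'))%:C = (Num.sqrt 2 * s)%:C + (Num.sqrt 2 * s')%:C :> R[i].
  by rewrite mulrDr rmorphD.
rewrite sD !conjcM !conjcD !conjc_real; move: ee sq.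
move: (expi theta) (Num.sqrt 2 * s)%:C (Num.sqrt 2 * s')%:C => e a b ef ab.
apply/matrixP => i j; rewrite !mxE !big_ord_recl big_ord0 !mxE /=.
case: i => [[|[|[|//]]] ?]; case: j => [[|[|[|//]]] ?] /=; try by ring.
have -> : (- (s + s') ^+ 2 +i* (t + t')) =
    (- s ^+ 2 +i* t) + (- s' ^+ 2 +i* t') - a * b * (e * conjc e).
  rewrite ab ef mulr1; apply/eqP; rewrite eq_complex /= !subr0 eqxx andbT; apply/eqP; ring.
ring.
Qed.

(** This involution preserves [hform] but has determinant [-1], so it is kept as a matrix rather
    than an element of [SU21]. *)
Definition swap_mx : 'M[R[i]]_3 := mx3 [:: [:: 0; 0; 1]; [:: 0; 1; 0]; [:: 1; 0; 0]].

Lemma swap_mxK n (M : 'M[R[i]]_(3, n)) : swap_mx *m (swap_mx *m M) = M.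
Proof.
rewrite mulmxA (_ : swap_mx *m swap_mx = 1%:M) ?mul1mx//.
apply/matrixP => i j; rewrite !mxE !big_ord_recl big_ord0 !mxE /=.
by case: i => [[|[|[|//]]] ?]; case: j => [[|[|[|//]]] ?] /=; ring.
Qed.

Lemma translation_oE s theta t :
  translation_o_mx s theta t = swap_mx *m translation_infty_mx s theta t *m swap_mx.
Proof.
apply/matrixP => i j; rewrite !mxE !big_ord_recl big_ord0 !mxE /= !big_ord_recl !big_ord0 !mxE /=.
by case: i => [[|[|[|//]]] ?]; case: j => [[|[|[|//]]] ?] /=; ring.
Qed.

Lemma translation_inftyE s theta t :
  translation_infty_mx s theta t = swap_mx *m translation_o_mx s theta t *m swap_mx.
Proof.
rewrite translation_oE -!mulmxA swap_mxK.
by rewrite -[swap_mx *m swap_mx]mulmx1 -mulmxA swap_mxK mulmx1.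
Qed.

Lemma translation_oD s theta t s' t' :
  (translation_o s theta t * translation_o s' theta t')%g =
  translation_o (s + s') theta (t + t').
Proof.
apply/val_inj => /=; rewrite !translation_oE -!mulmxA swap_mxK.
by have /(congr1 val)/= <- := translation_inftyD s theta t s' t'; rewrite !mulmxA.
Qed.

End Translations.

Section OneParameterSubgroup.
Variables (R : realFieldType) (gT : groupType) (T : R -> gT).
Hypothesis TD : forall j k, T (j + k) = (T j * T k)%g.

(** Lets the geometric estimates treat all positive powers of a letter at once, through a real
    parameter [k = n.+1] or [- n.+1]. *)
Lemma one_parameter_power (e : bool) n :
  exists2 k, int_sqr k & ((if e then (T 1)^-1 else T 1) ^+ n.+1)%g = T k.
Proof.
have T0 : T 0 = 1%g by apply: (@mulgI _ (T 0)); rewrite -TD addr0 mulg1.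
have TN k : T (- k) = (T k)^-1%g.
  by apply: (@mulgI _ (T k)); rewrite -TD subrr mulgV.
have Tn k m : (T k ^+ m)%g = T (k *+ m).
  by elim: m => [|m IHm]; rewrite ?expg0 ?mulr0n ?expgS ?mulrS ?TD ?IHm.
have n1 : int_sqr (n.+1%:R : R).
  rewrite /int_sqr; case: n => [|n]; first by rewrite expr1n eqxx.
  apply/orP; right; by rewrite -natrX ler_nat (@leq_exp2r 2 _ 2).
exists (if e then - n.+1%:R else n.+1%:R).
  by case: e; rewrite // /int_sqr sqrrN.
by case: e; rewrite -?TN Tn ?mulNrn.
Qed.

End OneParameterSubgroup.

(** * Continuity of the real part and the modulus *)

Section ComplexContinuity.
Variable R : realType.
Local Open Scope complex_scope.
Local Notation normc := Normc.normc.

Lemma complex_normE (z : R[i]) : `|z| = (normc z)%:C.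
Proof. by case: z => a b; rewrite normc_def. Qed.

Lemma lipschitz1_complex_continuous (f : R[i]^o -> R) :
  (forall z w : R[i], `|f z - f w| <= normc (z - w)) -> continuous f.
Proof.
move=> f1 z A /nbhs_ballP[e e0 eA]; apply/nbhs_ballP.
exists e%:C => /=; first by rewrite ltcR.
move=> w zw; apply: eA; apply: le_lt_trans (f1 _ _) _.
by move: zw; rewrite /ball /= complex_normE ltcR.
Qed.

Lemma Re_continuous : continuous (fun z : R[i]^o => complex.Re z).
Proof.
apply: lipschitz1_complex_continuous => -[a b] [c d] /=.
by rewrite -sqrtr_sqr ler_wsqrtr// lerDl sqr_ge0.
Qed.

Lemma normc_continuous : continuous (fun z : R[i]^o => normc z).
Proof.
apply: lipschitz1_complex_continuous => z w.
have := le_normcD (z - w) w; have := le_normcD (w - z) z.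
rewrite !subrK -(normcN (w - z)) opprB => zw wz.
by rewrite ler_norml; apply/andP; split; lra.
Qed.

End ComplexContinuity.

(** * Ping-pong tables for two one-parameter families *)

Section PingPongTables.
Variable R : realType.
Local Notation vec := 'cV[R[i]^o]_3.

(* [A k] and [B k] stand for the [k]-th powers of the two generators. *)
Definition ping_pong_table (A B : R -> 'M[R[i]]_3) : Prop :=
  exists U V : set 'cV[R[i]]_3, exists u : vec,
  [/\ forall k z, int_sqr k -> U z -> V (A k *m z),
      forall k z, int_sqr k -> V z -> U (B k *m z),
      U u & \forall z \near u, ~ V z].

Lemma ping_pong_table_swap (A B : R -> 'M[R[i]]_3) :
  ping_pong_table A B ->
  ping_pong_table (fun k => swap_mx R *m A k *m swap_mx R)
                  (fun k => swap_mx R *m B k *m swap_mx R).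
Proof.
move=> [U [V [u [AU BV Uu Vu]]]].
exists [set z | U (swap_mx R *m z)], [set z | V (swap_mx R *m z)], (swap_mx R *m u).
split=> [k z sk Uz|k z sk Vz||] /=.
- by rewrite -!mulmxA swap_mxK; apply: AU.
- by rewrite -!mulmxA swap_mxK; apply: BV.
- by rewrite swap_mxK.
have := @mulmx_continuous R[i] 3 3 1 1 (swap_mx R) 1%:M (swap_mx R *m u) [set z | ~ V z].
rewrite mulmx1 swap_mxK => /(_ Vu).
rewrite /= nbhs_filterE; congr (nbhs _ _).
by apply/funext => z /=; rewrite mulmx1.
Qed.

(** The index [a] names the generator whose powers map [U] into [V], so a table serves with the
    generators in either order. *)
Lemma ping_pong_table_discrete_free (x : bool -> SU21 R) (M : bool -> R -> SU21 R) a :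
  (forall b, x b = M b 1) -> (forall b j k, M b (j + k) = (M b j * M b k)%g) ->
  ping_pong_table (fun k => SU21_mx (M a k)) (fun k => SU21_mx (M (~~ a) k)) ->
  discrete (generated (range x)) /\ free_basis x (generated (range x)).
Proof.
move=> xM MD [U [V [u [AU BV Uu Vu]]]].
pose D b := if b == a then U else V.
have Da : D a = U by rewrite /D eqxx.
have Dna : D (~~ a) = V by rewrite /D; case: (a).
have powD b e n z : D b z -> D (~~ b) (SU21_mx (letter_value x (b, e) ^+ n.+1)%g *m z).
  have [k sk ek] := one_parameter_power (MD b) e n.
  have -> : (letter_value x (b, e) ^+ n.+1)%g = M b k.
    by rewrite -ek -xM.
  have [->|ne] := eqVneq b a; first by rewrite Da Dna; apply: AU.
  have -> : b = ~~ a by move: ne; case: (b); case: (a).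
  by rewrite negbK Da Dna; apply: BV.
have Du : D a u by rewrite Da.
have Dn : \forall z \near u, ~ D (~~ a) z by rewrite Dna.
by split; [exact: (ping_pong_discrete powD Du Dn)|exact: (ping_pong_free powD Du Dn)].
Qed.

End PingPongTables.

(** * Cygan balls and the first condition *)

Section BallTable.
Variable R : realType.
Local Open Scope complex_scope.
Local Notation normc := Normc.normc.
Implicit Types (s theta t k : R) (z : 'cV[R[i]]_3).

Lemma normc_conj (x : R[i]) : normc (conjc x) = normc x.
Proof. by case: x => a b /=; rewrite sqrrN. Qed.

Lemma normc_ge0 (x : R[i]) : 0 <= normc x.
Proof. by case: x => a b /=; rewrite sqrtr_ge0. Qed.

Lemma normc_gt0 (x : R[i]) : (0 < normc x) = (x != 0).
Proof. by rewrite -ltcR -complex_normE normr_gt0. Qed.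

Lemma cygan_ge0 s t : 0 <= cygan s t.
Proof. exact: sqrtr_ge0. Qed.

Lemma cygan_sqr s t : cygan s t ^+ 2 = normc (- s ^+ 2 +i* t).
Proof. by rewrite sqr_sqrtr ?normc_ge0//= sqrrN. Qed.

Lemma cygan_exp4 s t : cygan s t ^+ 4 = s ^+ 4 + t ^+ 2.
Proof.
rewrite (exprM _ 2 2) cygan_sqr /= sqr_sqrtr ?addr_ge0 ?sqr_ge0//.
by rewrite sqrrN -exprM.
Qed.

Lemma cygan_step s t k : int_sqr k -> cygan s t <= cygan (k * s) (k * t).
Proof.
move=> sk; rewrite -(@ler_pXn2r _ 4) ?nnegrE ?cygan_ge0// !cygan_exp4 !exprMn.
have k1 : 1 <= k ^+ 2 by case/orP: sk => [/eqP ->//|]; lra.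
rewrite (exprM k 2 2) lerD// ler_peMl ?sqr_ge0 ?exprn_even_ge0//.
by rewrite exprn_ege1.
Qed.

Lemma translation_inftyE0 s theta t z :
  (translation_infty_mx s theta t *m z) 0 0 =
  z 0 0 - conjc ((Num.sqrt 2 * s)%:C * expi theta) * z 1 0 + (- s ^+ 2 +i* t) * z 2 0.
Proof. by rewrite mx3_mul /= heis_conj mul1r mulNr. Qed.

Lemma translation_inftyE1 s theta t z :
  (translation_infty_mx s theta t *m z) 1 0 =
  z 1 0 + (Num.sqrt 2 * s)%:C * expi theta * z 2 0.
Proof. by rewrite mx3_mul /= mul0r add0r mul1r. Qed.

Lemma translation_inftyE2 s theta t z : (translation_infty_mx s theta t *m z) 2 0 = z 2 0.
Proof. by rewrite mx3_mul /= !mul0r !add0r mul1r. Qed.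

Lemma translation_oE2 s theta t z :
  (translation_o_mx s theta t *m z) 2 0 =
  (- s ^+ 2 +i* t) * z 0 0 - (Num.sqrt 2 * s)%:C * conjc (expi theta) * z 1 0 + z 2 0.
Proof. by rewrite mx3_mul /= expiN mul1r mulNr. Qed.

Lemma swapE z : [/\ (swap_mx R *m z) 0 0 = z 2 0, (swap_mx R *m z) 1 0 = z 1 0 &
  (swap_mx R *m z) 2 0 = z 0 0].
Proof. by split; rewrite mx3_mul /= !mul0r mul1r ?add0r ?addr0. Qed.

Lemma hform_swap z : hform (swap_mx R *m z) (swap_mx R *m z) = hform z z.
Proof. by rewrite /hform; case: (swapE z) => -> -> ->; ring. Qed.

Lemma hform_SU21 (M : SU21 R) z : hform (SU21_mx M *m z) (SU21_mx M *m z) = hform z z.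
Proof. by case: M => M /= /andP[_ /asboolP]. Qed.

(** Nullity says [|z_1|^2 = - 2 Re (z_0 conj z_2)]. *)
Lemma null_normc1 z : hform z z = 0 -> normc (z 1 0) ^+ 2 <= 2 * (normc (z 0 0) * normc (z 2 0)).
Proof.
move=> nz; have -> : normc (z 1 0) ^+ 2 = normc (- (conjc (z 2 0) * z 0 0 + conjc (z 0 0) * z 2 0)).
  rewrite expr2 -{1}normc_conj -Normc.normcM; congr normc.
  by apply/eqP; rewrite -subr_eq0 opprK -nz /hform; apply/eqP; ring.
rewrite normcN; apply: le_trans (le_normcD _ _) _.
by rewrite !Normc.normcM !normc_conj; lra.
Qed.

(* From the identity [c |z_2|^2 = <Tz, z>], valid for null [z]. *)
Lemma translation_infty_ball s theta t rho z :
  4 * rho <= cygan s t ^+ 2 -> hform z z = 0 ->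
  normc (z 0 0) < rho * normc (z 2 0) ->
  rho * normc (z 2 0) < normc ((translation_infty_mx s theta t *m z) 0 0).
Proof.
move=> rho4 nz z0; rewrite ltNge; apply/negP => z0'.
set z' := translation_infty_mx s theta t *m z in z0'.
have nz' : hform z' z' = 0 by have := hform_SU21 (translation_infty s theta t) z; rewrite nz.
have z2' : z' 2 0 = z 2 0 by exact: translation_inftyE2.
have E : (- s ^+ 2 +i* t) * (z 2 0 * conjc (z 2 0)) =
    z' 0 0 * conjc (z 2 0) + conjc (z 0 0) * z 2 0 + conjc (z' 1 0) * z 1 0.
  rewrite translation_inftyE0 translation_inftyE1.
  rewrite -[RHS](subr0) -nz /hform conjcD.
  move: (_ * expi theta) (- s ^+ 2 +i* t) => a c; rewrite !conjcM.
  ring.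
have := le_normcD (z' 0 0 * conjc (z 2 0) + conjc (z 0 0) * z 2 0) (conjc (z' 1 0) * z 1 0).
have := le_normcD (z' 0 0 * conjc (z 2 0)) (conjc (z 0 0) * z 2 0).
rewrite -E !Normc.normcM !normc_conj -cygan_sqr.
have := null_normc1 nz; have := null_normc1 nz'; rewrite z2'.
move: (normc_ge0 (z 0 0)) (normc_ge0 (z 1 0)) (normc_ge0 (z 2 0)) 
  (normc_ge0 (z' 1 0)) (normc_ge0 (z' 0 0)) z0 z0' rho4.
move: (normc (z 0 0)) (normc (z 1 0)) (normc (z 2 0)) (normc (z' 1 0)) 
  (normc (z' 0 0)) (cygan s t ^+ 2) (normc (_ + _)).
move=> a b d b' a' c e a0 b0 d0 b'0 a'0 ad a'd c4 h' h e1 e2.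
have d_gt0 : 0 < d.
  by rewrite lt_neqAle d0 andbT; apply/eqP => d00; move: ad; rewrite -d00; lra.
(* Nullity and [2 * b * b' <= b^2 + b'^2] give [b * b' <= (a + a') * d], hence [c * d^2 <= 2 * (a +
   a') * d < 4 * rho * d^2], against the choice of [rho]. *)
have : (a + a') * d < 2 * rho * d * d by rewrite ltr_pM2r//; lra.
have : 4 * rho * (d * d) <= c * (d * d) by rewrite ler_wpM2r// mulr_ge0.
have := sqr_ge0 (b - b').
lra.
Qed.

(** For null [z], [|z_0| / |z_2|] is the squared Cygan norm of the boundary point, so [rho] is a
    squared radius: the largest that [translation_infty_ball] allows for [A]. Since the norms have
    product at least 4, [rho^-1] is allowed for [B] after exchanging [o] and infinity. *)
Lemma ball_table s1 theta1 t1 s2 theta2 t2 :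
  4 <= cygan s1 t1 * cygan s2 t2 ->
  ping_pong_table (fun k => translation_infty_mx (k * s1) theta1 (k * t1))
                  (fun k => translation_o_mx (k * s2) theta2 (k * t2)).
Proof.
move=> q12; pose rho := cygan s1 t1 ^+ 2 / 4.
have q1 : 0 < cygan s1 t1.
  by rewrite lt_neqAle cygan_ge0 andbT; apply/eqP => q0; move: q12; rewrite -q0; lra.
have rho0 : 0 < rho by rewrite divr_gt0// exprn_gt0.
have q2 : 4 * rho^-1 <= cygan s2 t2 ^+ 2.
  rewrite ler_pdivrMr// /rho.
  have : 4 ^+ 2 <= (cygan s1 t1 * cygan s2 t2) ^+ 2.
    by rewrite ler_pXn2r ?nnegrE ?mulr_ge0 ?cygan_ge0.
  by rewrite exprMn; lra.
exists [set z | hform z z = 0 /\ normc (z 0 0) < rho * normc (z 2 0)].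
exists [set z | hform z z = 0 /\ rho * normc (z 2 0) < normc (z 0 0)].
(* The base point is [o], the centre of the ball. *)
exists (\col_i (i == 2)%:R).
have qk s t k : int_sqr k -> cygan s t ^+ 2 <= cygan (k * s) (k * t) ^+ 2.
  by move=> sk; rewrite ler_pXn2r ?nnegrE ?cygan_ge0// cygan_step.
split=> [k z sk [nz z0]|k z sk [nz z0]||].
- split; first by rewrite (hform_SU21 (translation_infty _ _ _)).
  rewrite translation_inftyE2; apply: translation_infty_ball nz z0.
  by apply: le_trans (qk _ _ _ sk); rewrite /rho; lra.
- split; first by rewrite (hform_SU21 (translation_o _ _ _)).
  rewrite translation_oE -!mulmxA; set w := swap_mx R *m z.
  case: (swapE z) => w0 _ w2.
  case: (swapE (translation_infty_mx (k * s2) theta2 (k * t2) *m w)) => -> _ ->.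
  rewrite translation_inftyE2 w2 -ltr_pdivrMl// -w2.
  apply: translation_infty_ball; [exact: le_trans q2 (qk _ _ _ sk)|by rewrite hform_swap|].
  by rewrite w0 w2 ltr_pdivlMl.
- split; rewrite ?/hform !mxE !mulr0n !mulr1n.
    by rewrite conjc0 !(mul0r, mulr0, addr0).
  by rewrite Normc.normc0 Normc.normc1 mulr1.
have : {for (\col_i (i == 2)%:R : 'cV[R[i]^o]_3),
    continuous (fun z : 'cV[R[i]^o]_3 => rho * normc (z 2 0) - normc (z 0 0))}.
  apply: continuousB; last first.
    exact: continuous_comp (@coord_continuous _ _ _ _ _ _) (@normc_continuous _ _).
  apply: continuousM; first exact: cst_continuous.
  exact: continuous_comp (@coord_continuous _ _ _ _ _ _) (@normc_continuous _ _).
move=> /cvgr_gt /(_ 0); rewrite !mxE !mulr0n !mulr1n.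
rewrite Normc.normc1 Normc.normc0 mulr1 subr0 => /(_ rho0).
by apply: filterS => z z0 [_]; rewrite ltNge -subr_ge0 ltW.
Qed.

End BallTable.

(** * Projections of isometric spheres to a line *)

(** The right-hand side is [|c p - 2 s e w + 1|^2] with [c = - s^2 + i t], [p = a + i b],
    [e = co + i si], [w = X + i Y]. Pairing with [- c] by Cauchy-Schwarz eliminates [b] and leaves
    [N] times the squared distance from [w] to [(A / N, - B / N)], of which only the [X] part is
    kept. *)
Lemma isometric_sphere_real (R : realFieldType) (s t a b X Y co si : R) :
  let N := s ^+ 4 + t ^+ 2 in
  0 < N -> a = - (X ^+ 2 + Y ^+ 2) -> co ^+ 2 + si ^+ 2 = 1 ->
  (X - s * (s ^+ 2 * co - t * si) / N) ^+ 4 * N <=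
  (- s ^+ 2 * a - t * b - 2 * s * (co * X - si * Y) + 1) ^+ 2
  + (t * a - s ^+ 2 * b - 2 * s * (si * X + co * Y)) ^+ 2.
Proof.
move=> N N0 -> cs; set vr := (Z in _ <= Z ^+ 2 + _); set vi := (Z in _ <= _ + Z ^+ 2).
set A := s * (_ - _); pose B := s * (t * co + s ^+ 2 * si).
have AB : A ^+ 2 + B ^+ 2 = s ^+ 2 * N.
  by rewrite -[RHS]mulr1 -cs /A /B /N; ring.
have E : N * ((X - A / N) ^+ 2 + (Y + B / N) ^+ 2) = s ^+ 2 * vr + (- t) * vi.
  have -> : N * ((X - A / N) ^+ 2 + (Y + B / N) ^+ 2) =
      N * (X ^+ 2 + Y ^+ 2) - 2 * A * X + 2 * B * Y + (A ^+ 2 + B ^+ 2) / N.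
    by field; rewrite gt_eqF.
  by rewrite AB mulfK ?gt_eqF// /A /B /N /vr /vi; ring.
have C := Cauchy_2d (s ^+ 2) (- t) vr vi.
rewrite -(ler_pM2r N0) [leRHS]mulrC.
have -> : (X - A / N) ^+ 4 * N * N = (N * (X - A / N) ^+ 2) ^+ 2 by ring.
have NE : N = (s ^+ 2) ^+ 2 + (- t) ^+ 2 by rewrite sqrrN -exprM.
rewrite [X in _ <= X * _]NE; apply: le_trans C; rewrite -E.
have P0 : 0 <= N * (X - A / N) ^+ 2 by rewrite mulr_ge0 ?sqr_ge0// ltW.
have PQ : N * (X - A / N) ^+ 2 <= N * ((X - A / N) ^+ 2 + (Y + B / N) ^+ 2).
  by rewrite ler_pM2l// lerDl sqr_ge0.
by rewrite ler_pXn2r ?nnegrE// (le_trans P0 PQ).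
Qed.

(** Replacing [s], [t] by [s / q], [t / q^2], with [q = cygan s t], makes the Cygan norm 1 and
    multiplies centres and radii by [q]. The term added to the centre is minus the midpoint of the
    centres for [k = 1] and [k = -1]. *)
Lemma ball_in_strip (R : realType) (s t k co si h : R) :
  0 < s -> 0 <= co -> co ^+ 2 + si ^+ 2 = 1 -> int_sqr k ->
  1 + co <= h * cygan s t ->
  exists r, [/\ 0 < r, r ^+ 4 * ((k * s) ^+ 4 + (k * t) ^+ 2) = 1 &
    `|k * s * ((k * s) ^+ 2 * co - k * t * si) / ((k * s) ^+ 4 + (k * t) ^+ 2)
      + s * t * si / (s ^+ 4 + t ^+ 2)| + r <= h].
Proof.
move=> s0 co0 cs sk; have := cygan_exp4 s t; have := cygan_ge0 s t.
move: (cygan s t) => q q_ge0 q4 hq.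
have q0 : 0 < q by rewrite lt_neqAle q_ge0 andbT; apply/eqP => q0; move: hq; rewrite -q0; lra.
have xt : (s / q) ^+ 4 + (t / q ^+ 2) ^+ 2 = 1.
  rewrite (_ : _ + _ = (s ^+ 4 + t ^+ 2) / q ^+ 4); last by field; rewrite gt_eqF.
  by rewrite -q4 divff// expf_neq0// gt_eqF.
have k1 : 1 <= k ^+ 2 by case/orP: sk => [/eqP ->//|]; lra.
have k0 : k != 0 by apply/eqP => k0; move: k1; rewrite k0 expr0n ler10.
have D0 : 0 < k ^+ 2 * s ^+ 4 + t ^+ 2.
  apply: ltr_wpDr; first exact: sqr_ge0.
  by rewrite mulr_gt0 ?(lt_le_trans ltr01 k1)// exprn_gt0.
have [r [r0 rE b]] := ball_in_strip_scaled (divr_ge0 (ltW s0) q_ge0) xt co0 cs sk.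
exists (r / q); split; first exact: divr_gt0.
  rewrite -rE; field; exact: lt0r_neq0.
rewrite -(ler_pM2r q0); apply: le_trans hq; apply: le_trans b.
rewrite mulrDl divfK ?gt_eqF// lerD2r -[X in _ * X <= _](gtr0_norm q0) -normrM le_eqVlt.
apply/orP; left; apply/eqP; congr `|_|.
rewrite -q4.
have kD : (k * s) ^+ 4 + (k * t) ^+ 2 = k ^+ 2 * (k ^+ 2 * s ^+ 4 + t ^+ 2) by ring.
have kD0 : 0 < (k * s) ^+ 4 + (k * t) ^+ 2.
  by rewrite kD mulr_gt0 ?(lt_le_trans ltr01 k1).
by field; rewrite !gt_eqF.
Qed.

(** * Fans and the second condition *)

Section FanTable.
Variable R : realType.
Local Open Scope complex_scope.
Local Notation normc := Normc.normc.
Implicit Types (s theta t k : R) (z : 'cV[R[i]]_3).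

(* [Re (e^(- i theta) zeta)] for [zeta] the horizontal coordinate of the
   Heisenberg point with standard lift [z / z_2]. *)
Definition fan theta z : R := complex.Re (conjc (expi theta) * (z 1 0 / z 2 0)) / Num.sqrt 2.

Let sqrt2_neq0 : Num.sqrt 2 != 0 :> R.
Proof. by rewrite gt_eqF// sqrtr_gt0. Qed.

Lemma fan_translation s theta t z : z 2 0 != 0 ->
  fan theta (translation_infty_mx s theta t *m z) = fan theta z + s.
Proof.
move=> z2; rewrite /fan translation_inftyE1 translation_inftyE2 mulrDl mulfK// mulrDr.
have -> : conjc (expi theta) * ((Num.sqrt 2 * s)%:C * expi theta) = (Num.sqrt 2 * s)%:C.
  by rewrite mulrCA [conjc _ * _]mulrC expi_conj mulr1.
rewrite raddfD /= mulrDl.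
by congr (_ + _); field.
Qed.

(** With [w = e^(- i theta1) zeta] and [p = z_0 / z_2], nullity reads [Re p = - |w|^2] and
    [isometric_sphere_real] applies. Consequently, if the translation does not increase [|z_2|], the
    fan coordinate is within [N^(-1/4)] of the projected centre. *)
Lemma isometric_sphere s t theta1 theta2 z :
  let co := cos (theta1 - theta2) in let si := sin (theta1 - theta2) in
  let N := s ^+ 4 + t ^+ 2 in
  0 < N -> hform z z = 0 -> z 2 0 != 0 ->
  (fan theta1 z - s * (s ^+ 2 * co - t * si) / N) ^+ 4 * N * normc (z 2 0) ^+ 2 <=
    normc ((translation_o_mx s theta2 t *m z) 2 0) ^+ 2.
Proof.
move=> co si N N0 nz z2.
pose q := (Num.sqrt 2)%:C : R[i].
have q0 : q != 0 by rewrite -(rmorph0 (real_complex R)) (inj_eq (@complexI _)).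
have qq : q * q = 2 by rewrite -rmorphM -expr2 sqr_sqrtr// rmorph_nat.
pose w := conjc (expi theta1) * (z 1 0 / z 2 0) / q; pose p := z 0 0 / z 2 0.
have z0E : z 0 0 = p * z 2 0 by rewrite /p divfK.
have z1E : z 1 0 = q * expi theta1 * w * z 2 0.
  rewrite /w; have := expi_conj theta1; move: (expi theta1) (conjc _) => e f ef.
  by rewrite -[LHS]mul1r -ef; field; rewrite z2 q0.
have fanE : fan theta1 z = complex.Re w.
  rewrite /fan; have -> : conjc (expi theta1) * (z 1 0 / z 2 0) = q * w.
    by rewrite /w [RHS]mulrC divfK.
  by case: (w) => X Y; rewrite /= mul0r subr0 mulrC mulKf.
clearbody p w.
have pw : complex.Re p = - (complex.Re w ^+ 2 + complex.Im w ^+ 2).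
  have : (p + conjc p + 2 * (w * conjc w)) * (z 2 0 * conjc (z 2 0)) = 0.
    rewrite -nz /hform z0E z1E !conjcM conjc_real -qq.
    have := expi_conj theta1; move: (expi theta1) (conjc (expi _)) => e f ef.
    apply/eqP; rewrite -subr_eq0; apply/eqP.
    transitivity (q * q * (w * conjc w) * (z 2 0 * conjc (z 2 0)) * (1 - e * f)); first by ring.
    by rewrite ef subrr mulr0.
  move/eqP; rewrite mulf_eq0 mulf_eq0 conjc_eq0 orbb (negPf z2) orbF.
  case: (p) (w) => a b [X Y]; rewrite eq_complex /= => /andP[/eqP] + _; lra.
have uE : (translation_o_mx s theta2 t *m z) 2 0 =
    ((- s ^+ 2 +i* t) * p - (2 * s)%:C * (expi (theta1 - theta2) * w) + 1) * z 2 0.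
  rewrite translation_oE2 z0E z1E.
  have -> : (Num.sqrt 2 * s)%:C = q * s%:C by rewrite rmorphM.
  have -> : (2 * s)%:C = q * q * s%:C by rewrite qq rmorphM rmorph_nat.
  have -> : expi (theta1 - theta2) = expi theta1 * conjc (expi theta2).
    by apply/eqP; rewrite eq_complex /= cosB sinB; apply/andP; split; apply/eqP; ring.
  ring.
rewrite uE Normc.normcM exprMn fanE ler_wpM2r ?sqr_ge0//.
move: pw; case: (p) (w) => a b [X Y] /= pw.
rewrite sqr_sqrtr ?addr_ge0 ?sqr_ge0//.
apply: le_trans (isometric_sphere_real b N0 pw (cos2Dsin2 (theta1 - theta2))) _.
rewrite le_eqVlt; apply/orP; left; apply/eqP; ring.
Qed.

Lemma fan_table s1 theta1 t1 s2 theta2 t2 :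
  0 < s1 -> 0 < s2 -> 0 <= cos (theta1 - theta2) ->
  2 * (1 + cos (theta1 - theta2)) <= s1 * cygan s2 t2 ->
  ping_pong_table (fun k => translation_infty_mx (k * s1) theta1 (k * t1))
                  (fun k => translation_o_mx (k * s2) theta2 (k * t2)).
Proof.
move=> s1_gt0 s2_gt0; have cs := cos2Dsin2 (theta1 - theta2).
have isom := fun k => @isometric_sphere (k * s2) (k * t2) theta1 theta2.
move: isom cs; rewrite /=; move: (cos _) (sin _) => co si isom cs co0 hq.
pose h := s1 / 2; pose c0 := - (s2 * t2 * si / (s2 ^+ 4 + t2 ^+ 2)).
have hq' : 1 + co <= h * cygan s2 t2 by rewrite /h; lra.
(* Both forms are needed: the contrapositive of the lax one shows that powers of [B] strictly
   increase [|z_2|] on [V], and the strict one gives membership in the open fan. *)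
have in_strip k z (lax : bool) : int_sqr k -> hform z z = 0 -> z 2 0 != 0 ->
    (normc ((translation_o_mx (k * s2) theta2 (k * t2) *m z) 2 0) < normc (z 2 0) ?<= if lax) ->
    (`|fan theta1 z - c0| < h ?<= if lax).
  move=> sk nz z2 uz.
  have [r [r0 rE rh]] := ball_in_strip s2_gt0 co0 cs sk hq'.
  have N0 : 0 < (k * s2) ^+ 4 + (k * t2) ^+ 2.
    by rewrite -(pmulr_rgt0 _ (exprn_gt0 4 r0)) rE.
  have := isom k z N0 nz z2.
  set P := _ / _ in rh *; set X := fan _ _ => I.
  suff : `|X - P| < r ?<= if lax.
    have : `|X - c0| <= `|X - P| + `|P - c0|.
      by rewrite (_ : X - c0 = (X - P) + (P - c0)) ?ler_normD//; ring.
    move: rh; rewrite /c0 opprK.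
    by case: (lax) => /=; lra.
  have z20 : 0 < normc (z 2 0) by rewrite normc_gt0.
  have I' : `|X - P| ^+ 4 * normc (z 2 0) ^+ 2 <=
      r ^+ 4 * normc ((translation_o_mx (k * s2) theta2 (k * t2) *m z) 2 0) ^+ 2.
    rewrite -normrX ger0_norm ?exprn_even_ge0//.
    rewrite -(ler_pM2l (exprn_gt0 4 r0)) in I.
    apply: le_trans I; rewrite le_eqVlt; apply/orP; left; apply/eqP.
    rewrite -[LHS]mul1r -rE; ring.
  case: lax uz => /= uz.
    rewrite -(@ler_pXn2r _ 4) ?nnegrE ?(ltW r0)//.
    rewrite -(ler_pM2r (exprn_gt0 2 z20)); apply: le_trans I' _.
    by rewrite ler_pM2l ?exprn_gt0// ler_pXn2r ?nnegrE ?normc_ge0.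
  rewrite -(@ltr_pXn2r _ 4) ?nnegrE ?(ltW r0)//.
  rewrite -(ltr_pM2r (exprn_gt0 2 z20)); apply: le_lt_trans I' _.
  by rewrite ltr_pM2l ?exprn_gt0// ltr_pXn2r ?nnegrE ?normc_ge0.
have k_ge1 k : int_sqr k -> 1 <= `|k|.
  move=> sk; rewrite -(@ler_pXn2r _ 2) ?nnegrE// expr1n real_normK ?num_real//.
  by case/orP: sk => [/eqP ->//|]; lra.
exists [set z | [/\ hform z z = 0, z 2 0 != 0 & `|fan theta1 z - c0| < h]].
exists [set z | [/\ hform z z = 0, z 2 0 != 0 & h < `|fan theta1 z - c0|]].
(* The standard lift of the Heisenberg point [(c0 e^(i theta1), 0)], on the median of the fan. *)
pose u : 'cV[R[i]^o]_3 := \col_i [:: - (c0 ^+ 2)%:C; (Num.sqrt 2 * c0)%:C * expi theta1; 1]`_i.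
have h0 : 0 < h by rewrite divr_gt0.
have u2 : u 2 0 = 1 by rewrite mxE.
have u1 : u 1 0 = (Num.sqrt 2 * c0)%:C * expi theta1 by rewrite mxE.
have u0 : u 0 0 = - (c0 ^+ 2)%:C by rewrite mxE.
have fan_u : fan theta1 u = c0.
  by rewrite /fan u2 divr1 u1 mulrCA [conjc _ * _]mulrC expi_conj mulr1 /= mulrC mulKf.
exists u; split=> [k z sk [nz z2 zU]|k z sk [nz z2 zV]||].
- split; first by rewrite (hform_SU21 (translation_infty _ _ _)).
    by rewrite translation_inftyE2.
  rewrite fan_translation//.
  have : s1 <= `|k * s1| by rewrite normrM (gtr0_norm s1_gt0) ler_peMl ?k_ge1// ltW.
  have := ler_normB (fan theta1 z + k * s1 - c0) (fan theta1 z - c0).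
  rewrite (_ : _ - (fan theta1 z - c0) = k * s1); last by ring.
  by move: zU; rewrite /h; lra.
- set z' := translation_o_mx (k * s2) theta2 (k * t2) *m z.
  have lt_z' : normc (z 2 0) < normc (z' 2 0).
    rewrite ltNge; apply/negP => uz.
    by have := in_strip k z true sk nz z2 uz; rewrite /= leNgt zV.
  have nz' : hform z' z' = 0 by rewrite (hform_SU21 (translation_o _ _ _)).
  have z'2 : z' 2 0 != 0 by rewrite -normc_gt0 (le_lt_trans (normc_ge0 _) lt_z').
  (* [B^-k] takes [z'] back to [z], whose last coordinate is smaller, so [z'] is inside the
     isometric sphere of [B^-k]. *)
  split=> //; apply: (in_strip (- k) z' false) => //; first by rewrite /int_sqr sqrrN.
  suff -> : translation_o_mx (- k * s2) theta2 (- k * t2) *m z' = z by [].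
  rewrite /z' mulmxA.
  have /(congr1 val)/= -> := translation_oD (- k * s2) theta2 (- k * t2) (k * s2) (k * t2).
  have T0 : translation_o 0 theta2 0 = 1%g :> SU21 R.
    by apply: (@mulgI _ (translation_o 0 theta2 0)); rewrite translation_oD !addr0 mulg1.
  by rewrite !mulNr !addNr; have /(congr1 val)/= -> := T0; rewrite mul1mx.
- split; last by rewrite fan_u subrr normr0.
    rewrite /hform u0 u1 u2 conjc1 conjcM conjcN !conjc_real.
    rewrite [X in _ + X + _](_ : _ = (2 * c0 ^+ 2)%:C).
      by rewrite mul1r mulr1 addrAC -opprD -rmorphD -rmorphN -rmorphD; congr (_%:C); ring.
    rewrite mulrACA [conjc _ * _]mulrC expi_conj mulr1 -rmorphM; congr (_%:C).
    by rewrite mulrACA -expr2 sqr_sqrtr// expr2.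
  by rewrite u2 oner_neq0.
have cf : {for u, continuous (fun z : 'cV[R[i]^o]_3 => fan theta1 z - c0)}.
  apply: continuousB; last exact: cst_continuous.
  apply: continuousM; last exact: cst_continuous.
  apply: (@continuous_comp _ R[i]^o R
    (fun z : 'cV[R[i]^o]_3 => conjc (expi theta1) * (z 1 0 / z 2 0) : R[i]^o));
    last exact: Re_continuous.
  apply: (@continuousM R[i]); first exact: cst_continuous.
  apply: (@continuousM R[i]); first exact: coord_continuous.
  apply: (@continuousV R[i]); first by rewrite u2 oner_neq0.
  exact: coord_continuous.
have near_h : \forall z \near u, `|fan theta1 z - c0| < h.
  apply: (cvgr_lt _ (cvg_norm cf)).
  by rewrite fan_u subrr normr0.
by apply: filterS near_h => z zh [_ _]; rewrite ltNge (ltW zh).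
Qed.

End FanTable.

Theorem theorem1p4 (R : realType) (s1 theta1 t1 s2 theta2 t2 : R)
    (s1_ge0 : 0 <= s1) (s2_ge0 : 0 <= s2)
    (nontriv1 : (s1, t1) <> (0, 0)) (nontriv2 : (s2, t2) <> (0, 0))
    (angle : s1 <> 0 -> s2 <> 0 ->
      - (pi / 2) <= theta1 - theta2 <= pi / 2)
    (cond :
      [\/ 4 <= cygan s1 t1 * cygan s2 t2,
          [/\ s1 <> 0, s2 <> 0 &
            4 * cos ((theta1 - theta2) / 2) ^+ 2 <= s1 * cygan s2 t2] |
          [/\ s1 <> 0, s2 <> 0 &
            4 * cos ((theta1 - theta2) / 2) ^+ 2 <= cygan s1 t1 * s2]]) :
  let A := translation_infty s1 theta1 t1 in
  let B := translation_o s2 theta2 t2 in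
  let G := generated [set A; B] in
  discrete G /\ free_basis (fun b : bool => if b then A else B) G.
Proof.
have -> : (let A := translation_infty s1 theta1 t1 in
    let B := translation_o s2 theta2 t2 in
    let G := generated [set A; B] in
    discrete G /\ free_basis (fun b : bool => if b then A else B) G) =
  (let x (b : bool) := if b then translation_infty s1 theta1 t1
                       else translation_o s2 theta2 t2 in
   discrete (generated (range x)) /\ free_basis x (generated (range x))).
  set A := translation_infty _ _ _; set B := translation_o _ _ _.
  rewrite /= (_ : [set A; B] = range (fun b : bool => if b then A else B))//.
  apply/seteqP; split=> [M [->|->]|M [[] _ <-]]; [by exists true|by exists false|by left|by right].
set x := fun b : bool => _.
pose M (b : bool) k := if b then translation_infty (k * s1) theta1 (k * t1)
                       else translation_o (k * s2) theta2 (k * t2).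
have xM b : x b = M b 1 by rewrite /x /M; case: b; rewrite !mul1r.
have MD b j k : M b (j + k) = (M b j * M b k)%g.
  by rewrite /M; case: b; rewrite ?translation_inftyD ?translation_oD !mulrDl.
(* The half-angle formula gives the width required by [fan_table]. *)
have half : 4 * cos ((theta1 - theta2) / 2) ^+ 2 = 2 * (1 + cos (theta1 - theta2)).
  have {2}-> : theta1 - theta2 = ((theta1 - theta2) / 2) *+ 2.
    by rewrite -mulr_natr divfK// pnatr_eq0.
  by rewrite cos_mulr2n; lra.
have pos (s : R) : 0 <= s -> s <> 0 -> 0 < s.
  by move=> s_ge0 /eqP s_neq0; rewrite lt_neqAle eq_sym s_neq0.
case: cond => [q12|[n1 n2 q]|[n1 n2 q]].
- by apply: (ping_pong_table_discrete_free xM MD (a := true)); exact: ball_table.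
- apply: (ping_pong_table_discrete_free xM MD (a := true)); apply: fan_table.
  + exact: pos.
  + exact: pos.
  + by apply: cos_ge0_pihalf; exact: angle.
  + by rewrite -half.
(* Here [B] shifts the fan: the table is built with the two sets of parameters exchanged, which
   leaves the cosine unchanged, and then conjugated by [swap_mx]. *)
- apply: (ping_pong_table_discrete_free xM MD (a := false)).
  have := @fan_table _ s2 theta2 t2 s1 theta1 t1 (pos _ s2_ge0 n2) (pos _ s1_ge0 n1).
  rewrite -(opprB theta1) cosN => /(_ (cos_ge0_pihalf (angle n1 n2))).
  rewrite -half [s2 * _]mulrC => /(_ q) /ping_pong_table_swap.
  congr (ping_pong_table _ _); apply/funext => k /=.
    by rewrite translation_oE.
  by rewrite translation_inftyE.
Qed.
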